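(* Let $K$ be a field and $n\ge 3$. Consider the following bilinear products on $UT_n(K)$ (in each item, the products of pairs of basis elements that are not listed are zero): (1) $\mathbf{M}^{(12),1}_{i,j}$ for $1<i\le n$, $1\le j<n$: $e_{i-1,i}*e_{j,j+1}=e_{1n}$; (2) $\mathbf{M}^{(12),2}_i$ for $1\le i<n$: $e_{12}*e_{i,i+1}=e_{1,n-1}$, $e_{i,i+1}*e_{n-1,n}=e_{2n}$; (3) $\mathbf{M}^{(12),3}_{i,j}$ for $1\le i<j\le n$, $j>i+2$: $e_{ik}*e_{kj}=e_{1n}$ for all $i<k<j$; (4) $\mathbf{M}^{(12),4}$: $e_{ik}*e_{kj}=e_{ij}$ for all $1\le i<k<j\le n$ with $(i,j)\ne(1,n)$. If $n>4$, then the $(12)$-matching structures on $UT_n(K)$ are exactly the associative products that are $K$-linear combinations of the products (1), (2), (3), (4). If $n=4$, then the $(12)$-matching structures on $UT_n(K)$ are exactly the associative products that are $K$-linear combinations of the products (1), (2), (3). If $n=3$, then the $(12)$-matching structures on $UT_n(K)$ are exactly the associative products that are $K$-linear combinations of the products (1), (2).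
   Context: $K$ is an arbitrary field; all products are $K$-bilinear. $UT_n(K)$ is the associative algebra of strictly upper triangular $n\times n$ matrices over $K$ with the usual matrix product $\cdot$; it has the $K$-basis of matrix units $e_{ij}$ (also written $e_{i,j}$), $1\le i<j\le n$, with $e_{ij}\cdot e_{kl}=\delta_{jk}e_{il}$. A $(12)$-matching structure on an associative algebra $(A,\cdot)$ is an associative bilinear product $*$ on the vector space $A$ such that $(a\cdot b)*c=a*(b\cdot c)$ and $(a*b)\cdot c=a\cdot(b*c)$ for all $a,b,c\in A$. Linear combinations of products are taken in the vector space of bilinear maps $UT_n(K)\times UT_n(K)\to UT_n(K)$. *)

(* Defs.v *)
From HB Require Import structures.
From mathcomp Require Import all_boot all_order all_algebra.

Set Implicit Arguments.
Unset Strict Implicit.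
Unset Printing Implicit Defensive.

Import GRing.Theory.
Local Open Scope ring_scope.

Definition is_bilinear (K : fieldType) (A : lmodType K) (f : A -> A -> A) :=
  bilinear_for (GRing.Scale.Law.clone _ _ *:%R _)
    (GRing.Scale.Law.clone _ _ *:%R _) f.

Record matching12 (K : fieldType) (A : lmodType K) (dot star : A -> A -> A) :
    Prop := Matching12 {
  matching12_bilinear : is_bilinear star;
  matching12_assoc : associative star;
  matching12_ds : forall a b c, star (dot a b) c = star a (dot b c);
  matching12_sd : forall a b c, dot (star a b) c = dot a (star b c) }.

Section StrictlyUpper.
Variables (K : fieldType) (n : nat).

Definition strict_upper : {pred 'M[K]_n} :=
  [pred A : 'M[K]_n | [forall i : 'I_n, forall j : 'I_n, (j <= i)%N ==> (A i j == 0)]].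

Lemma strict_upperP (A : 'M[K]_n) :
  reflect (forall i j : 'I_n, (j <= i)%N -> A i j = 0) (A \in strict_upper).
Proof.
apply: (iffP forallP) => [h i j ji | h i].
  by move/forallP: (h i) => /(_ j); rewrite ji => /eqP.
by apply/forallP => j; apply/implyP => /h ->.
Qed.

Lemma strict_upper_submod : submod_closed strict_upper.
Proof.
split; first by apply/strict_upperP => i j _; rewrite mxE.
move=> a A B /strict_upperP hA /strict_upperP hB; apply/strict_upperP.
by move=> i j ji; rewrite !mxE hA // hB // mulr0 addr0.
Qed.

HB.instance Definition _ :=
  GRing.isSubmodClosed.Build K 'M[K]_n strict_upper strict_upper_submod.

Record UT := MkUT { ut_mx :> 'M[K]_n; _ : ut_mx \in strict_upper }.

HB.instance Definition _ := [isSub for ut_mx].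
HB.instance Definition _ := [Choice of UT by <:].
HB.instance Definition _ := [SubChoice_isSubLmodule of UT by <:].

Lemma UT_eq0 (A : UT) (i j : 'I_n) : (j <= i)%N -> A i j = 0.
Proof. exact: (strict_upperP _ (valP A)). Qed.

Lemma mulmx_strict_upper (A B : UT) : ut_mx A *m ut_mx B \in strict_upper.
Proof.
apply/strict_upperP => i j ji; rewrite mxE big1 // => k _.
case: (leqP k i) => [ki | ik]; first by rewrite UT_eq0 ?mul0r.
by rewrite [X in _ * X]UT_eq0 ?mulr0 // (leq_trans ji) // ltnW.
Qed.

Definition ut_dot (A B : UT) : UT := MkUT (mulmx_strict_upper A B).

Lemma ut_unit_strict_upper (i j : nat) :
  \matrix_(k < n, l < n)
    [&& i == k.+1, j == l.+1 & (k < l)%N]%:R \in strict_upper.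
Proof.
by apply/strict_upperP => k l lk; rewrite mxE ltnNge lk !andbF.
Qed.

(* Matrix units are indexed by naturals counted from 1; [ut_unit i j] is the
   zero matrix unless [1 <= i < j <= n]. *)
Definition ut_unit (i j : nat) : UT := MkUT (ut_unit_strict_upper i j).

(* The bilinear product sending the pair of basis elements (e_ij, e_kl) to
   [T i j k l], see [ut_ext_unit]. *)
Definition ut_ext (T : nat -> nat -> nat -> nat -> UT) (A B : UT) : UT :=
  \sum_(i < n) \sum_(j < n | (i < j)%N) \sum_(k < n) \sum_(l < n | (k < l)%N)
    (A i j * B k l) *: T i.+1 j.+1 k.+1 l.+1.

Definition M12_1 (i j : nat) : UT -> UT -> UT :=
  ut_ext (fun p q r s =>
    if [&& p == i.-1, q == i, r == j & s == j.+1] then ut_unit 1 n else 0).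

(* For n >= 3 the two conditions exclude each other. *)
Definition M12_2 (i : nat) : UT -> UT -> UT :=
  ut_ext (fun p q r s =>
    if [&& p == 1, q == 2, r == i & s == i.+1]%N then ut_unit 1 n.-1
    else if [&& p == i, q == i.+1, r == n.-1 & s == n] then ut_unit 2 n
    else 0).

Definition M12_3 (i j : nat) : UT -> UT -> UT :=
  ut_ext (fun p q r s =>
    if [&& p == i, q == r & s == j] then ut_unit 1 n else 0).

Definition M12_4 : UT -> UT -> UT :=
  ut_ext (fun p q r s =>
    if (q == r) && ((p, s) != (1%N, n)) then ut_unit p s else 0).

Definition comb1 (c : nat -> nat -> K) (a b : UT) : UT :=
  \sum_(2 <= i < n.+1) \sum_(1 <= j < n) c i j *: M12_1 i j a b.

Definition comb2 (c : nat -> K) (a b : UT) : UT :=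
  \sum_(1 <= i < n) c i *: M12_2 i a b.

Definition comb3 (c : nat -> nat -> K) (a b : UT) : UT :=
  \sum_(1 <= i < n.+1) \sum_(1 <= j < n.+1 | (i + 2 < j)%N)
    c i j *: M12_3 i j a b.

Lemma ut_dotA : associative ut_dot.
Proof. by move=> A B C; apply: val_inj; rewrite /= mulmxA. Qed.

Lemma ut_dot_bilinear : is_bilinear ut_dot.
Proof.
split=> [C|C] a A B; apply: val_inj; rewrite !linearP /=.
  by rewrite mulmxDl scalemxAl.
by rewrite mulmxDr scalemxAr.
Qed.

Lemma ut_ext_bilinear T : is_bilinear (ut_ext T).
Proof.
split=> [C|C] a A B; rewrite /ut_ext /= scaler_sumr -big_split /=;
  apply: eq_bigr => i _; rewrite scaler_sumr -big_split /=;
  apply: eq_bigr => j _; rewrite scaler_sumr -big_split /=;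
  apply: eq_bigr => k _; rewrite scaler_sumr -big_split /=;
  apply: eq_bigr => l _; rewrite scalerA -scalerDl !mxE.
  by rewrite mulrDl mulrA.
by rewrite mulrDr mulrCA.
Qed.

Lemma ut_unitE (i j : 'I_n) : (i < j)%N ->
  ut_mx (ut_unit i.+1 j.+1) = delta_mx i j.
Proof.
move=> ij; apply/matrixP => k l.
rewrite !mxE !eqSS (eq_sym (val i)) (eq_sym (val j)) -!val_eqE /=.
by congr ((_)%:R); case: eqP => //= ->; case: eqP => //= ->; rewrite ij.
Qed.

Lemma ut_dot_unit (i j k l : 'I_n) : (i < j)%N -> (k < l)%N ->
  ut_dot (ut_unit i.+1 j.+1) (ut_unit k.+1 l.+1)
    = if j == k then ut_unit i.+1 l.+1 else 0.
Proof.
move=> ij kl; apply: val_inj.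
transitivity (delta_mx i j *m delta_mx k l : 'M[K]_n).
  by rewrite -!ut_unitE.
case: eqP => [jk | /eqP jk]; last by rewrite mul_delta_mx_0.
by rewrite -jk mul_delta_mx -ut_unitE // (ltn_trans ij) // jk.
Qed.

Lemma ut_unit_span (A : UT) :
  A = \sum_(i < n) \sum_(j < n | (i < j)%N) A i j *: ut_unit i.+1 j.+1.
Proof.
apply: val_inj; rewrite raddf_sum [LHS]matrix_sum_delta.
apply: eq_bigr => i _; rewrite raddf_sum [RHS]big_mkcond.
apply: eq_bigr => j _; case: (ltnP i j) => ij.
  by rewrite -ut_unitE.
by rewrite UT_eq0 // scale0r.
Qed.

Lemma ut_ext_unit T (i j k l : 'I_n) : (i < j)%N -> (k < l)%N ->
  ut_ext T (ut_unit i.+1 j.+1) (ut_unit k.+1 l.+1)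
    = T i.+1 j.+1 k.+1 l.+1.
Proof.
move=> ij kl; rewrite /ut_ext !ut_unitE //.
rewrite (bigD1 i) //= (bigD1 j) //= (bigD1 k) //= (bigD1 l) //= !mxE !eqxx.
rewrite mulr1 scale1r !big1 ?addr0 // => [i' hi | j' /andP[_ hj] |
  k' hk | l' /andP[_ hl]]; try (apply: big1 => ? _); try (apply: big1 => ? _);
  try (apply: big1 => ? _).
- by rewrite !mxE (negPf hi) mul0r scale0r.
- by rewrite !mxE (negPf hj) andbF mul0r scale0r.
- by rewrite !mxE (negPf hk) mulr0 scale0r.
- by rewrite !mxE (negPf hl) andbF mulr0 scale0r.
Qed.

End StrictlyUpper.

Arguments ut_dot {K n}.

(* Main.v *)
Require Import Defs.
From mathcomp Require Import all_boot all_order all_algebra.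
From mathcomp Require Import zify.

Set Implicit Arguments.
Unset Strict Implicit.
Unset Printing Implicit Defensive.

Import GRing.Theory.
Local Open Scope ring_scope.

(** The proof works with structure constants.  Let [star] be a matching
product, let [e i j] be the matrix units, and read each matching identity on
three of them.

The identity (a.b)*c = a*(b.c) says that [star] is balanced: a unit [e i j]
with [j > i + 1] can be cut at any intermediate index and part of it moved to
the other factor.  Hence [e i j * e k l] vanishes when [j != k], unless both
units lie on the first superdiagonal ([star_dot_eq0], [dot_star_eq0]), and
[e i j * e j l] does not depend on the middle index [j] ([star_middle]).

The identity (a*b).c = a.(b*c) moves coefficients around, because multiplying
by [e p q] on the right turns column [p] into column [q] and multiplying by
[e i j] on the left turns row [j] into row [i].  It forces [e i j * A] to live
in row [i] and column [n], and [A * e p q] in column [q] and row 1; moreover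
the [(i, p)] coefficient of [e i j * A] equals the [(j, q)] coefficient of
[A * e p q] ([coef_star_shift]).  Since the former does not involve [q] and
the latter does not involve [i], these coefficients are independent of both.

Combining the two, [coef_star_inner] finds all coefficients of [e i j * e k l]
outside column [n]; shifting gives those of column [n] below the first row.
Only two phenomena survive: the [(i, l)] coefficient of [e i j * e j l], which
is one constant [c4] for all [(i, l) != (1, n)], and the common value of
the [(1, n-1)] coefficient of [e 1 2 * e k k.+1] and the [(2, n)] coefficient
of [e k k.+1 * e n.-1 n].  These are the families [M12_4] and [M12_2].  The
corner [(1, n)] is annihilated by multiplication on either side, so it is only
subject to balancedness; this gives [M12_3] for [j = k] and [l > i + 2], and
[M12_1] for pairs on the first superdiagonal.  When [n = 4] the product
[M12_4] is [M12_2] with [i = 2], and when [n = 3] it is zero: this is why [c4]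
may then be taken to be 0.

Conversely the two matching identities are linear in the product, so a linear
combination satisfies them as soon as the table of its values on matrix units
does ([comb_ds], [comb_sd]). *)

(** * Sums and bilinear maps *)

Lemma sum_nat_pick (V : nmodType) (a b i0 : nat) (P : pred nat)
    (F : nat -> V) :
  (forall i, (a <= i < b)%N -> P i -> i != i0 -> F i = 0) ->
  \sum_(a <= i < b | P i) F i =
    if (a <= i0 < b)%N && P i0 then F i0 else 0.
Proof.
move=> F0; rewrite big_mkcond; case: (boolP (a <= i0 < b)%N) => [i0ab | i0ab].
  rewrite (bigD1_seq i0) ?mem_index_iota ?iota_uniq //=.
  rewrite big_seq_cond big1 ?addr0 //.
  move=> i; rewrite mem_index_iota => /andP[iab ni].
  by case: ifP => // Pi; rewrite F0.
rewrite big_nat_cond big1 //= => i /andP[iab _]; case: ifP => // Pi.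
by rewrite F0 //; apply: contraNneq i0ab => <-.
Qed.

Section Bilinear.
Variables (K : fieldType) (A : lmodType K).
Implicit Types f g : A -> A -> A.

Lemma bilinear_left f : is_bilinear f ->
  forall a x y z, f (a *: x + y) z = a *: f x z + f y z.
Proof. by case=> fl _ a x y z; exact: (fl z). Qed.

Lemma bilinear_right f : is_bilinear f ->
  forall a x y z, f x (a *: y + z) = a *: f x y + f x z.
Proof. by case=> _ fr a x y z; exact: (fr x). Qed.

(** Restates bilinearity with the scaling of the module itself, in place of the
generic scaling laws that the definition carries. *)
Lemma bilinearI f :
  (forall a x y z, f (a *: x + y) z = a *: f x z + f y z) ->
  (forall a x y z, f x (a *: y + z) = a *: f x y + f x z) -> is_bilinear f.
Proof. by move=> fl fr; split=> z a x y; [exact: fl | exact: fr]. Qed.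

Lemma bilinear0l f x : is_bilinear f -> f 0 x = 0.
Proof.
by move=> /bilinear_left/(_ (-1) 0 0 x); rewrite scaler0 addr0 scaleN1r addNr.
Qed.

Lemma bilinear0r f x : is_bilinear f -> f x 0 = 0.
Proof.
by move=> /bilinear_right/(_ (-1) x 0 0); rewrite scaler0 addr0 scaleN1r addNr.
Qed.

Lemma bilinear_add f g : is_bilinear f -> is_bilinear g ->
  is_bilinear (fun x y => f x y + g x y).
Proof.
move=> fB gB; apply: bilinearI => a x y z.
  by rewrite (bilinear_left fB) (bilinear_left gB) scalerDr addrACA.
by rewrite (bilinear_right fB) (bilinear_right gB) scalerDr addrACA.
Qed.

Lemma bilinear_scale c f : is_bilinear f ->
  is_bilinear (fun x y => c *: f x y).
Proof.
move=> fB; apply: bilinearI => a x y z.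
  by rewrite (bilinear_left fB) scalerDr !scalerA mulrC.
by rewrite (bilinear_right fB) scalerDr !scalerA mulrC.
Qed.

Lemma bilinear_sum (I : Type) (r : seq I) (P : pred I) (F : I -> A -> A -> A) :
  (forall i, is_bilinear (F i)) ->
  is_bilinear (fun x y => \sum_(i <- r | P i) F i x y).
Proof.
move=> FB; apply: bilinearI => a x y z;
  rewrite scaler_sumr -big_split /=; apply: eq_bigr => i _.
  by rewrite (bilinear_left (FB i)).
by rewrite (bilinear_right (FB i)).
Qed.

End Bilinear.

Lemma eq_if (T : Type) (b b' : bool) (x y : T) :
  b = b' -> (if b then x else y) = (if b' then x else y).
Proof. by move=> ->. Qed.

(** Erases the branches excluded by the arithmetic hypotheses. *)
Ltac drop_ifs := repeat match goal with |- context [if ?b then _ else _] =>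
  let H := fresh in assert (H : b = false) by lia; rewrite H; clear H end.

(** * Coordinates in the basis of matrix units *)

Section MatchingStructures.
Variables (K : fieldType) (m : nat).
Local Notation n := m.+3.
Local Notation e := (@ut_unit K n).
Implicit Types (A B : UT K n).

(** Rows and columns are counted from 1, as for [ut_unit], so that all index
manipulations take place in [nat]; outside [1..n] the value is arbitrary. *)
Definition coef A (p q : nat) : K := ut_mx A (inord p.-1) (inord q.-1).

Lemma coefD A B p q : coef (A + B) p q = coef A p q + coef B p q.
Proof. by rewrite /coef mxE. Qed.

Lemma coefZ a A p q : coef (a *: A) p q = a * coef A p q.
Proof. by rewrite /coef mxE. Qed.

Lemma coef0 p q : coef 0 p q = 0.
Proof. by rewrite /coef mxE. Qed.

Lemma coef_unit i j p q : (0 < p < q)%N -> (q <= n)%N ->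
  coef (e i j) p q = if (p == i) && (q == j) then 1 else 0.
Proof.
move=> p0 qn; rewrite /coef mxE !inordK; [|lia..].
rewrite (_ : [&& _, _ & _] = (p == i) && (q == j)); last by lia.
by case: ifP.
Qed.

Lemma coef_lower A p q : (0 < q <= p)%N -> (p <= n)%N -> coef A p q = 0.
Proof. by move=> qp pn; rewrite /coef UT_eq0 // !inordK; lia. Qed.

Lemma coef_ext A B :
  (forall p q, (0 < p < q)%N -> (q <= n)%N -> coef A p q = coef B p q) ->
  A = B.
Proof.
move=> h; apply: val_inj; apply/matrixP => i j /=.
case: (ltnP i j) => ij; last by rewrite !UT_eq0.
have := h i.+1 j.+1; rewrite /coef /= !inord_val; apply=> //=.
Qed.

Lemma coef_dot_unitr A p q r s :
  (0 < p < q)%N -> (q <= n)%N -> (0 < r <= n)%N -> (0 < s <= n)%N ->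
  coef (ut_dot A (e p q)) r s = if s == q then coef A r p else 0.
Proof.
move=> pq qn rn sn; rewrite /coef mxE.
rewrite (bigD1 (inord p.-1)) //= big1 ?addr0 => [|k kp].
  rewrite mxE !inordK; [|lia..].
  rewrite (_ : [&& _, _ & _] = (s == q)); last by lia.
  by case: ifP; rewrite ?(mulr0, mulr1).
rewrite mxE !inordK; [|lia..].
case: (boolP [&& _, _ & _]) => [h | _]; last by rewrite mulr0.
by case/eqP: kp; apply: val_inj; rewrite /= inordK; lia.
Qed.

Lemma coef_dot_unitl A i j r s :
  (0 < i < j)%N -> (j <= n)%N -> (0 < r <= n)%N -> (0 < s <= n)%N ->
  coef (ut_dot (e i j) A) r s = if r == i then coef A j s else 0.
Proof.
move=> ij jn rn sn; rewrite /coef mxE.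
rewrite (bigD1 (inord j.-1)) //= big1 ?addr0 => [|k kp].
  rewrite mxE !inordK; [|lia..].
  rewrite (_ : [&& _, _ & _] = (r == i)); last by lia.
  by case: ifP; rewrite ?(mul0r, mul1r).
rewrite mxE !inordK; [|lia..].
case: (boolP [&& _, _ & _]) => [h | _]; last by rewrite mul0r.
by case/eqP: kp; apply: val_inj; rewrite /= inordK; lia.
Qed.

Lemma dot_unit i j k l : (0 < i < j)%N -> (j <= n)%N ->
  (0 < k < l)%N -> (l <= n)%N ->
  ut_dot (e i j) (e k l) = if j == k then e i l else 0.
Proof.
move=> ij jn kl ln; apply: coef_ext => p q pq qn.
rewrite coef_dot_unitr; [|lia..].
have -> : coef (e i j) p k = if (p == i) && (k == j) then 1 else 0.
  case: (leqP k p) => kp; last by rewrite coef_unit //; lia.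
  by rewrite coef_lower; [|lia..]; rewrite ifF //; lia.
case: (eqVneq j k) => jk; rewrite ?coef0 ?coef_unit //.
  by do ?case: ifP => //; lia.
by do ?case: ifP => //; lia.
Qed.

Lemma unit_ind (P : UT K n -> Prop) :
  (forall a A B, P A -> P B -> P (a *: A + B)) ->
  (forall i j, (0 < i < j)%N -> (j <= n)%N -> P (e i j)) ->
  forall A, P A.
Proof.
move=> PL Pe A.
have P0 : P 0.
  have P12 : P (e 1 2) by exact: Pe.
  by rewrite -(addNr (e 1 2)) -scaleN1r; exact: PL.
have PD A1 A2 : P A1 -> P A2 -> P (A1 + A2).
  by move=> P1 P2; rewrite -[A1]scale1r; exact: PL.
rewrite (ut_unit_span A); apply: big_ind => // i _; apply: big_ind => // j ij.
by rewrite -[_ *: _]addr0; apply: PL => //; apply: Pe; have := ltn_ord j; lia.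
Qed.

Lemma bilinear_eq (f g : UT K n -> UT K n -> UT K n) :
  is_bilinear f -> is_bilinear g ->
  (forall i j k l, (0 < i < j)%N -> (j <= n)%N -> (0 < k < l)%N ->
     (l <= n)%N -> f (e i j) (e k l) = g (e i j) (e k l)) ->
  forall A B, f A B = g A B.
Proof.
move=> fB gB fg; elim/unit_ind => [a A1 A2 h1 h2 B | i j ij jn].
  by rewrite (bilinear_left fB) (bilinear_left gB) h1 h2.
elim/unit_ind => [a A1 A2 h1 h2 | k l kl ln].
  by rewrite (bilinear_right fB) (bilinear_right gB) h1 h2.
exact: fg.
Qed.

(** * Linear combinations of the four families *)

Section Combination.
Variables (c1 : nat -> nat -> K) (c2 : nat -> K).
Variables (c3 : nat -> nat -> K) (c4 : K).

Definition comb A B : UT K n :=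
  comb1 c1 A B + comb2 c2 A B + comb3 c3 A B + c4 *: M12_4 A B.

(** The values of [comb] on pairs of matrix units, see [comb_unit].  For
[n >= 3] the two rules that define the second family never apply to the same
pair, which is why they appear here as separate summands. *)
Definition table (i j k l : nat) : UT K n :=
  (if (j == i.+1) && (l == k.+1) then c1 j k *: e 1 n else 0)
  + (if [&& i == 1, j == 2 & l == k.+1]%N then c2 k *: e 1 n.-1 else 0)
  + (if [&& j == i.+1, k == n.-1 & l == n] then c2 i *: e 2 n else 0)
  + (if (j == k) && (i + 2 < l)%N then c3 i l *: e 1 n else 0)
  + (if (j == k) && ~~ ((i == 1%N) && (l == n)) then c4 *: e i l else 0).

Lemma coef_if (b : bool) c i j p q : (0 < p < q)%N -> (q <= n)%N ->
  coef (if b then c *: e i j else 0) p q =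
    if [&& b, p == i & q == j] then c else 0.
Proof.
move=> pq qn; case: b; rewrite ?coef0 // coefZ coef_unit //=.
by case: ifP; rewrite ?(mulr0, mulr1).
Qed.

Lemma coef_table i j k l p q : (0 < p < q)%N -> (q <= n)%N ->
  coef (table i j k l) p q =
  (if [&& j == i.+1, l == k.+1, p == 1 & q == n]%N then c1 j k else 0)
  + (if [&& i == 1, j == 2, l == k.+1, p == 1 & q == n.-1]%N then c2 k else 0)
  + (if [&& j == i.+1, k == n.-1, l == n, p == 2 & q == n]%N then c2 i else 0)
  + (if [&& j == k, (i + 2 < l)%N, p == 1 & q == n]%N then c3 i l else 0)
  + (if [&& j == k, ~~ ((i == 1%N) && (l == n)), p == i & q == l]
     then c4 else 0).
Proof. by move=> pq qn; rewrite !coefD !coef_if // -!andbA. Qed.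

Lemma ext_unit T i j k l : (0 < i < j)%N -> (j <= n)%N ->
  (0 < k < l)%N -> (l <= n)%N ->
  ut_ext T (e i j) (e k l) = T i j k l.
Proof.
case: i => // i; case: j => // j; case: k => // k; case: l => // l.
move=> /= ij jn kl ln.
have i_n : (i < n)%N by lia.
have k_n : (k < n)%N by lia.
exact: (@ut_ext_unit K n T (Ordinal i_n) (Ordinal jn) (Ordinal k_n)
  (Ordinal ln)).
Qed.

Lemma comb_bilinear : is_bilinear comb.
Proof.
rewrite /comb /comb1 /comb2 /comb3.
do 3?apply: bilinear_add; repeat
  first [exact: ut_ext_bilinear | apply: bilinear_scale
        | apply: bilinear_sum => ?].
Qed.

Lemma comb_unit i j k l : (0 < i < j)%N -> (j <= n)%N ->
  (0 < k < l)%N -> (l <= n)%N -> comb (e i j) (e k l) = table i j k l.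
Proof.
move=> ij jn kl ln; rewrite /comb /table -(addrA (if _ then _ else _)).
have E1 : comb1 c1 (e i j) (e k l) =
    if (j == i.+1) && (l == k.+1) then c1 j k *: e 1 n else 0.
  rewrite /comb1 (@sum_nat_pick _ _ _ j) => [|i' _ _ ni]; last first.
    apply: big1 => j' _; rewrite /M12_1 ext_unit //.
    by case: ifP; rewrite ?scaler0 //; lia.
  rewrite (@sum_nat_pick _ _ _ k) => [|j' _ _ nj]; last first.
    by rewrite /M12_1 ext_unit //; case: ifP; rewrite ?scaler0 //; lia.
  rewrite /M12_1 ext_unit //.
  by do ?case: ifP; rewrite ?scaler0 //; lia.
have E2 : comb2 c2 (e i j) (e k l) =
    (if [&& i == 1, j == 2 & l == k.+1]%N then c2 k *: e 1 n.-1 else 0)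
    + (if [&& j == i.+1, k == n.-1 & l == n] then c2 i *: e 2 n else 0).
  (* The two rules of the second family pick different terms of the sum, so
     the sum is split before each is evaluated. *)
  pose g i' := (if [&& i == 1, j == 2, k == i' & l == i'.+1]%N
                then c2 i' *: e 1 n.-1 else 0).
  pose h i' := (if [&& i == i', j == i'.+1, k == n.-1 & l == n]%N
                then c2 i' *: e 2 n else 0).
  transitivity (\sum_(1 <= i' < n) (g i' + h i')).
    apply: eq_bigr => i' _; rewrite /M12_2 ext_unit // /g /h.
    by do ?case: ifP; rewrite ?(scaler0, addr0, add0r) //; lia.
  rewrite big_split /=; congr (_ + _).
    rewrite (@sum_nat_pick _ _ _ k) /g => [|i' _ _ ni].
      by do ?case: ifP => //; lia.
    by case: ifP => //; lia.
  rewrite (@sum_nat_pick _ _ _ i) /h => [|i' _ _ ni].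
    by do ?case: ifP => //; lia.
  by case: ifP => //; lia.
have E3 : comb3 c3 (e i j) (e k l) =
    if (j == k) && (i + 2 < l)%N then c3 i l *: e 1 n else 0.
  rewrite /comb3 (@sum_nat_pick _ _ _ i) => [|i' _ _ ni]; last first.
    apply: big1 => j' _; rewrite /M12_3 ext_unit //.
    by case: ifP; rewrite ?scaler0 //; lia.
  rewrite (@sum_nat_pick _ _ _ l) => [|j' _ _ nj]; last first.
    by rewrite /M12_3 ext_unit //; case: ifP; rewrite ?scaler0 //; lia.
  rewrite /M12_3 ext_unit //.
  by do ?case: ifP; rewrite ?scaler0 //; lia.
rewrite E1 E2 E3 /M12_4 ext_unit // -!addrA; do 4!congr (_ + _).
by rewrite xpair_eqE; case: ifP; rewrite ?scaler0.
Qed.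

(** A product of two matrix units lies off the first superdiagonal; there only
the third and fourth families act, and neither their values nor their
coefficients depend on the middle index. *)
Lemma comb_ds A B C : comb (ut_dot A B) C = comb A (ut_dot B C).
Proof.
have cB := comb_bilinear; have dB := @ut_dot_bilinear K n.
elim/unit_ind: A => [a A1 A2 h1 h2 | i j ij jn].
  by rewrite ?(bilinear_left cB, bilinear_left dB) h1 h2.
elim/unit_ind: B => [a A1 A2 h1 h2 | k l kl ln].
  by rewrite !(bilinear_right cB, bilinear_right dB, bilinear_left cB,
               bilinear_left dB) h1 h2.
elim/unit_ind: C => [a A1 A2 h1 h2 | p q pq qn].
  by rewrite !(bilinear_right cB, bilinear_right dB) h1 h2.
rewrite !dot_unit //.
case: (eqVneq j k) => jk; case: (eqVneq l p) => lp;
  rewrite ?(bilinear0l _ cB, bilinear0r _ cB) // !comb_unit; try lia;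
  rewrite /table.
- by rewrite jk lp !eqxx /=; drop_ifs; rewrite !add0r.
- by drop_ifs; rewrite !addr0.
- by drop_ifs; rewrite !addr0.
Qed.

(** Right multiplication by a unit kills column [n] and left multiplication
kills row 1, so of each side only two summands survive: the two rules of the
second family correspond to each other, and so do the two products of the
fourth family. *)
Lemma comb_sd A B C : ut_dot (comb A B) C = ut_dot A (comb B C).
Proof.
have cB := comb_bilinear; have dB := @ut_dot_bilinear K n.
elim/unit_ind: A => [a A1 A2 h1 h2 | i j ij jn].
  by rewrite ?(bilinear_left cB, bilinear_left dB) h1 h2.
elim/unit_ind: B => [a A1 A2 h1 h2 | k l kl ln].
  by rewrite !(bilinear_right cB, bilinear_right dB, bilinear_left cB,
               bilinear_left dB) h1 h2.
elim/unit_ind: C => [a A1 A2 h1 h2 | p q pq qn].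
  by rewrite !(bilinear_right cB, bilinear_right dB) h1 h2.
rewrite !comb_unit //; apply: coef_ext => r s rs sn.
rewrite coef_dot_unitr ?coef_dot_unitl; [|lia..].
transitivity (
  (if [&& i == 1, j == 2, l == k.+1, p == n.-1, r == 1 & s == n]%N
   then c2 k else 0)
  + (if [&& j == k, l == p, r == i & s == q] then c4 else 0)).
  case: (eqVneq s q) => sq; last by drop_ifs; rewrite addr0.
  case: (leqP p r) => pr.
    by rewrite coef_lower; [|lia..]; drop_ifs; rewrite addr0.
  rewrite coef_table; [|lia..].
  drop_ifs; rewrite ?(add0r, addr0).
  by congr (_ + _); apply: eq_if; lia.
case: (eqVneq r i) => ri; last by drop_ifs; rewrite addr0.
case: (leqP s j) => sj.
  by rewrite coef_lower; [|lia..]; drop_ifs; rewrite addr0.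
rewrite coef_table; [|lia..].
drop_ifs; rewrite ?(add0r, addr0).
by congr (_ + _); apply: eq_if; lia.
Qed.

Lemma comb_matching12 star : associative star ->
  (forall A B, star A B = comb A B) -> matching12 ut_dot star.
Proof.
have cB := comb_bilinear; move=> sA sE; split=> // [|A B C|A B C].
- apply: bilinearI => a A B C; rewrite !sE.
    exact: bilinear_left cB a A B C.
  exact: bilinear_right cB a A B C.
- by rewrite !sE comb_ds.
- by rewrite !sE comb_sd.
Qed.

End Combination.

(** * Coefficients of a matching product *)

Section Classification.
Variable star : UT K n -> UT K n -> UT K n.
Hypothesis star_matching : matching12 ut_dot star.

Let star_bilinear : is_bilinear star := matching12_bilinear star_matching.

Local Notation S i j k l := (coef (star (e i j) (e k l))).

(** Cut [e i j] at [i.+1] and move its right part across: that part is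
orthogonal to [e k l]. *)
Lemma star_dot_eq0 i j k l : (0 < i)%N -> (i.+1 < j)%N -> (j <= n)%N ->
  (0 < k < l)%N -> (l <= n)%N -> j != k -> star (e i j) (e k l) = 0.
Proof.
move=> i0 ij jn kl ln jk.
have -> : e i j = ut_dot (e i i.+1) (e i.+1 j).
  by rewrite dot_unit ?eqxx //; lia.
rewrite (matching12_ds star_matching) dot_unit; [|lia..].
by rewrite (negPf jk) bilinear0r.
Qed.

Lemma dot_star_eq0 i j k l : (0 < i < j)%N -> (j <= n)%N ->
  (0 < k)%N -> (k.+1 < l)%N -> (l <= n)%N -> j != k ->
  star (e i j) (e k l) = 0.
Proof.
move=> ij jn k0 kl ln jk.
have -> : e k l = ut_dot (e k k.+1) (e k.+1 l).
  by rewrite dot_unit ?eqxx //; lia.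
rewrite -(matching12_ds star_matching) dot_unit; [|lia..].
by rewrite (negPf jk) bilinear0l.
Qed.

(** The part of [e i j] right of [i.+1] is absorbed by [e j l], so every middle
index gives the same product as [i.+1]. *)
Lemma star_middle i j l : (0 < i < j)%N -> (j < l)%N -> (l <= n)%N ->
  star (e i j) (e j l) = star (e i i.+1) (e i.+1 l).
Proof.
move=> ij jl ln; case: (eqVneq j i.+1) => [-> //| ji].
have -> : e i j = ut_dot (e i i.+1) (e i.+1 j).
  by rewrite dot_unit ?eqxx //; lia.
rewrite (matching12_ds star_matching) dot_unit; [|lia..].
by rewrite eqxx.
Qed.

(** The [(r, s)] coefficient of the identity (a*b).c = a.(b*c) at
[a = e i j] and [c = e p q]. *)
Lemma coef_star_transfer A i j p q r s :
  (0 < i < j)%N -> (j <= n)%N -> (0 < p < q)%N -> (q <= n)%N ->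
  (0 < r <= n)%N -> (0 < s <= n)%N ->
  (if s == q then coef (star (e i j) A) r p else 0) =
  (if r == i then coef (star A (e p q)) j s else 0).
Proof.
move=> ij jn pq qn rn sn.
rewrite -(coef_dot_unitr _ pq qn rn sn) -(coef_dot_unitl _ ij jn rn sn).
by rewrite (matching12_sd star_matching).
Qed.

Lemma coef_star_shift A i j p q :
  (0 < i < j)%N -> (j <= n)%N -> (0 < p < q)%N -> (q <= n)%N ->
  coef (star (e i j) A) i p = coef (star A (e p q)) j q.
Proof.
move=> ij jn pq qn; have := @coef_star_transfer A i j p q i q ij jn pq qn.
by rewrite !eqxx; apply; lia.
Qed.

(** Multiplying on the right by [e p p.+1] detects the [(r, p)] coefficient,
while [e i j] on the left only produces row [i]. *)
Lemma coef_star_row A i j r p :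
  (0 < i < j)%N -> (j <= n)%N -> (0 < r <= n)%N -> (0 < p < n)%N ->
  r != i -> coef (star (e i j) A) r p = 0.
Proof.
move=> ij jn rn pn ri.
have := @coef_star_transfer A i j p p.+1 r p.+1 ij jn.
by rewrite eqxx (negPf ri); apply; lia.
Qed.

(** Dual of [coef_star_row]: [e 1 j] on the left detects row [j]. *)
Lemma coef_star_col A p q j s :
  (0 < p < q)%N -> (q <= n)%N -> (1 < j <= n)%N -> (0 < s <= n)%N ->
  s != q -> coef (star A (e p q)) j s = 0.
Proof.
move=> pq qn jn sn sq.
have := @coef_star_transfer A 1 j p q 1 s.
by rewrite eqxx (negPf sq) => /(_ _ _ pq qn) <- //; lia.
Qed.

(** The coefficients with which a matching product decomposes.  When
[n = 4] the fourth product coincides with the second one for [i = 2], whose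
coefficient [star_c2 2] then carries the contribution of both. *)
Definition star_c1 i j := S i.-1 i j j.+1 1 n.
Definition star_c2 k := S 1 2 k k.+1 1 n.-1.
Definition star_c3 i l := S i i.+1 i.+1 l 1 n.
Definition star_c4 := if (4 < n)%N then S 1 2 2 n.-1 1 n.-1 else 0.

(** Changing the middle index makes this coefficient independent of [k], and
shifting back and forth makes it independent of [i] and, symmetrically, of [l]:
the chain moves [(i, l)] to [(1, l)], then to [(2, n)], then to [(1, n-1)]. *)
Lemma coef_star_const i k l : (0 < i < k)%N -> (k < l < n)%N ->
  S i k k l i l = S 1 2 2 n.-1 1 n.-1.
Proof.
move=> ik kl.
rewrite (@coef_star_shift _ i k l n); [|lia..].
rewrite -(@coef_star_shift _ 1 k l n); [|lia..].
rewrite star_middle; [|lia..].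
rewrite (@coef_star_shift _ 1 2 l n); [|lia..].
rewrite star_middle; [|lia..].
rewrite -(@star_middle 2 n.-1 n); [|lia..].
by rewrite -(@coef_star_shift _ 1 2 n.-1 n); [|lia..].
Qed.

(** A coefficient that should vanish is shifted to a product [e k l * e p q],
where [q > p] is free, and possibly back to [e i' j * e k l], where [i' < j]
is free.  The free index is chosen so as to leave the first superdiagonal (two
steps away) or to leave the supporting row and column (one step away). *)
Lemma coef_star_inner i j k l p : (0 < i < j)%N -> (j <= n)%N ->
  (0 < k < l)%N -> (l <= n)%N -> (0 < p < n)%N ->
  S i j k l i p =
    (if [&& j == 2, l == k.+1 & p == n.-1]%N then star_c2 k else 0)
    + (if (j == k) && (p == l) then star_c4 else 0).
Proof.
move=> ij jn kl ln pn.
case: (eqVneq j k) => [jk | jk] /=; last first.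
  rewrite addr0; case: (ltnP 2 j) => j2.
    drop_ifs.
    rewrite (@coef_star_shift _ i j p n); [|lia..].
    rewrite -(@coef_star_shift _ (j - 2) j p n); [|lia..].
    by rewrite star_dot_eq0 ?coef0 //; lia.
  have [j2' i1] : j = 2 /\ i = 1%N by lia.
  subst i j; case: (eqVneq l k.+1) => lk; last first.
    by rewrite dot_star_eq0 ?coef0 //; lia.
  subst l; case: (eqVneq p n.-1) => [-> //| pn1] /=.
  case: (eqVneq p k.+1) => pk.
    rewrite (@coef_star_shift _ 1 2 p p.+1); [|lia..].
    by rewrite coef_star_row //; lia.
  rewrite (@coef_star_shift _ 1 2 p p.+2); [|lia..].
  by rewrite dot_star_eq0 ?coef0 //; lia.
subst j; case: (eqVneq p l) => [pl | pl].
  subst p; rewrite coef_star_const /star_c4; [|lia..].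
  (* The bounds give 1 < k < l < n, so for n <= 4 only n = 4 with k = 2 and
     l = 3 remains; the value is then counted in the first summand. *)
  case: (ltnP 4 n) => n4; first by drop_ifs; rewrite add0r.
  have [-> -> nE] : [/\ k = 2, l = 3 & n.-1 = 3]%N by split; lia.
  by rewrite ifT; [rewrite /star_c2 nE addr0 | lia].
rewrite addr0; case: (ltnP p n.-1) => pn1.
  drop_ifs.
  rewrite (@coef_star_shift _ i k p p.+2); [|lia..].
  by rewrite dot_star_eq0 ?coef0 //; lia.
have pE : p = n.-1 by lia.
subst p; rewrite eqxx andbT.
case: (ltnP 2 k) => k2.
  drop_ifs.
  rewrite (@coef_star_shift _ i k n.-1 n); [|lia..].
  rewrite -(@coef_star_shift _ k.-1 k n.-1 n); [|lia..].
  by rewrite coef_star_col //; lia.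
have [k2' i1] : k = 2 /\ i = 1%N by lia.
subst k i; case: (eqVneq l 3) => [-> //| l3] /=.
rewrite (@coef_star_shift _ 1 2 n.-1 n); [|lia..].
by rewrite star_dot_eq0 ?coef0 //; lia.
Qed.

Lemma star_combE A B : star A B = comb star_c1 star_c2 star_c3 star_c4 A B.
Proof.
move: A B; apply: bilinear_eq => //; first exact: comb_bilinear.
move=> i j k l ij jn kl ln; rewrite comb_unit //.
apply: coef_ext => r s rs sn; rewrite coef_table //.
case: (ltnP s n) => s_n.
  case: (eqVneq r i) => ri; last first.
    by rewrite coef_star_row; [|lia..]; drop_ifs; rewrite !addr0.
  subst r; rewrite coef_star_inner; [|lia..].
  drop_ifs; rewrite ?addr0 ?add0r.
  by congr (_ + _); apply: eq_if; lia.
(* In column n, a coefficient below row 1 is the shift of one outside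
   column n. *)
have sE : s = n by lia.
subst s; case: (ltnP 1 r) => r1.
  case: (eqVneq l n) => ln'; last first.
    by rewrite coef_star_col; [|lia..]; drop_ifs; rewrite ?addr0 ?add0r.
  subst l; rewrite -(@coef_star_shift _ r.-1 r k n); [|lia..].
  rewrite coef_star_inner; [|lia..].
  drop_ifs; rewrite ?addr0 ?add0r.
  by congr (_ + _); apply: eq_if; lia.
(* The corner (1, n). *)
have rE : r = 1%N by lia.
subst r.
case: (boolP ((j == i.+1) && (l == k.+1))) => [/andP[/eqP jE /eqP lE] | far].
  by subst j l; drop_ifs; rewrite !addr0 !eqxx.
case: (eqVneq j k) => jk; last first.
  drop_ifs; rewrite !addr0.
  case: (eqVneq j i.+1) => ji.
    by rewrite dot_star_eq0 ?coef0 //; lia.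
  by rewrite star_dot_eq0 ?coef0 //; lia.
subst k; rewrite star_middle; [|lia..].
by drop_ifs; rewrite ?addr0 ?add0r ifT //; lia.
Qed.

End Classification.

Lemma comb_c4_0 c1 c2 c3 A B :
  comb c1 c2 c3 0 A B = comb1 c1 A B + comb2 c2 A B + comb3 c3 A B.
Proof. by rewrite /comb scale0r addr0. Qed.

End MatchingStructures.

Lemma comb3_eq0 (K : fieldType) (n : nat) c (A B : UT K n) :
  (n <= 3)%N -> comb3 c A B = 0.
Proof.
move=> n3; rewrite /comb3 big_nat_cond big1 // => i /andP[i_n _].
by rewrite big_nat_cond big1 // => j /andP[j_n]; lia.
Qed.

(** * The classification *)

Theorem theorem3p18 (K : fieldType) (n : nat) (hn : (3 <= n)%N) :
  [/\ (4 < n)%N ->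
        forall star : UT K n -> UT K n -> UT K n,
          matching12 ut_dot star <->
          associative star /\
          exists (c1 : nat -> nat -> K) (c2 : nat -> K)
                 (c3 : nat -> nat -> K) (c4 : K),
            forall a b : UT K n,
              star a b = comb1 c1 a b + comb2 c2 a b + comb3 c3 a b
                         + c4 *: M12_4 a b,
      n = 4%N ->
        forall star : UT K n -> UT K n -> UT K n,
          matching12 ut_dot star <->
          associative star /\
          exists (c1 : nat -> nat -> K) (c2 : nat -> K)
                 (c3 : nat -> nat -> K),
            forall a b : UT K n,
              star a b = comb1 c1 a b + comb2 c2 a b + comb3 c3 a b
    & n = 3%N ->
        forall star : UT K n -> UT K n -> UT K n,
          matching12 ut_dot star <->
          associative star /\
          exists (c1 : nat -> nat -> K) (c2 : nat -> K),
            forall a b : UT K n,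
              star a b = comb1 c1 a b + comb2 c2 a b].
Proof.
case: n hn => [|[|[|m]]] // _.
split=> [n4 | [m1] | [m0]] star; split.
- move=> sM; split; first exact: matching12_assoc sM.
  by exists (star_c1 star), (star_c2 star), (star_c3 star), (star_c4 star);
    exact: star_combE.
- by case=> sA [c1 [c2 [c3 [c4 starE]]]]; exact: (comb_matching12 sA starE).
- move=> sM; split; first exact: matching12_assoc sM.
  exists (star_c1 star), (star_c2 star), (star_c3 star) => a b.
  by rewrite (star_combE sM) -comb_c4_0 /star_c4 ifF // m1.
- case=> sA [c1 [c2 [c3 starE]]].
  by apply: (@comb_matching12 _ _ c1 c2 c3 0) => // a b; rewrite comb_c4_0.
- move=> sM; split; first exact: matching12_assoc sM.
  exists (star_c1 star), (star_c2 star) => a b.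
  by rewrite (star_combE sM) /star_c4 ifF ?m0 // comb_c4_0 comb3_eq0 ?m0 ?addr0.
- case=> sA [c1 [c2 starE]].
  apply: (@comb_matching12 _ _ c1 c2 (fun _ _ => 0) 0) => // a b.
  by rewrite comb_c4_0 comb3_eq0 ?m0 // addr0.
Qed.
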